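(* Let $u_N$ be a solution of the FR-RBF semidiscretization of $\partial_t u+\partial_x(au)=0$ on $\Omega=[x_L,x_R]$ (with constant $a>0$), i.e. for all $t>0$ and $x\in\Omega$ $$\partial_t u_N(t,x) = - f_N'(t,x) - c_L'(x)\left[ f^{\mathrm{num}}_L(t) - f_N(t,x_L) \right] - c_R'(x) \left[ f^{\mathrm{num}}_R(t) - f_N(t,x_R) \right],$$ where the correction functions $c_L,c_R:\Omega\to\mathbb{R}$ satisfy $$c_L(x_R) = c_R(x_L) = 0, \qquad c_R(x_R) = c_L(x_L) = 1.$$ Then the FR-RBF method is conservative; that is, $$\frac{\mathrm{d}}{\mathrm{d} t} \int_\Omega u_N(t,x)\, \mathrm{d}x = - \left( f^{\mathrm{num}}_R(t) - f^{\mathrm{num}}_L(t) \right)$$ holds for all times $t>0$.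
   Context: Setting: the scalar linear advection equation $\partial_t u+\partial_x(au)=0$ for $x_L<x<x_R$, $t>0$, with constant $a>0$, flux function $f(u)=au$ and boundary condition $u(t,x_L)=g(t)$, $t>0$. RBF space: let $\phi:[0,\infty)\to\mathbb{R}$ be a radial basis function, $m\in\mathbb{N}$, and $X=\{x_n\}_{n=1}^N\subset\Omega$ a set of $N$ distinct centers. Let $p_1,\dots,p_Q$ be a basis of the polynomials of degree less than $m$. $V_{N,m}$ is the space of all functions $$v(x)=\sum_{n=1}^N\alpha_n\phi(|x-x_n|)+\sum_{i=1}^Q\beta_ip_i(x)\quad\text{with}\quad \sum_{n=1}^N\alpha_np_i(x_n)=0,\ i=1,\dots,Q.$$ It is assumed that interpolation at the centers is uniquely solvable in $V_{N,m}$ (so $\dim V_{N,m}=N$). The RBF interpolant of a function $w$ is the unique $v\in V_{N,m}$ with $v(x_n)=w(x_n)$ for $n=1,\dots,N$. At each time $t$, $u_N(t,\cdot)\in V_{N,m}$ is the approximation of the solution, and $f_N(t,\cdot)\in V_{N,m}$ is the corresponding RBF interpolant of the flux $f(u)$. A prime denotes $\partial_x$ (or $\mathrm{d}/\mathrm{d}x$). Functions in $V_{N,m}$ and the correction functions are continuously differentiable on $\Omega$, and $u_N$ is continuously differentiable in $t$. Numerical flux: $f^{\mathrm{num}}:\mathbb{R}^2\to\mathbb{R}$ is consistent ($f^{\mathrm{num}}(u,u)=f(u)$), Lipschitz continuous and monotone (nondecreasing in the first, nonincreasing in the second argument), and $f^{\mathrm{num}}_L(t)=f^{\mathrm{num}}(g_L(t),u_N(t,x_L))$,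 $f^{\mathrm{num}}_R(t)=f^{\mathrm{num}}(u_N(t,x_R),g_R(t))$. Here $g_L=g$ is the left boundary datum, and $g_R(t)$ is the right boundary value, taken as $u_N(t,x_R)$ since there is no boundary condition at the right for $a>0$. *)

(* Defs.v *)
From HB Require Import structures.
From mathcomp Require Import all_boot all_order all_algebra qpoly.
From mathcomp Require Import all_classical all_reals all_analysis.

Set Implicit Arguments.
Unset Strict Implicit.
Unset Printing Implicit Defensive.

Import Order.TTheory GRing.Theory Num.Theory.
Import numFieldNormedType.Exports.

Local Open Scope classical_set_scope.
Local Open Scope ring_scope.

(* Derivatives of functions living on a subset A of the line only.  On a       *)
(* closed interval this is the usual derivative in the interior and the        *)
(* one-sided derivative at the endpoints; values outside A are irrelevant.     *)
Section DerivativeWithin.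
Context {R : realType}.
Implicit Types (A : set R) (f : R -> R).

Definition derivable_within A f (x : R) : Prop :=
  cvg ((f y - f x) / (y - x) @[y --> within A x^']).

(* Meaningful only where derivable_within holds, as for derive1. *)
Definition derive_within A f (x : R) : R :=
  lim ((f y - f x) / (y - x) @[y --> within A x^']).

Definition C1_within A f : Prop :=
  (forall x, A x -> derivable_within A f x) /\
  {within A, continuous (derive_within A f)}.

End DerivativeWithin.

Section RBF.
Context {R : realType} (Omega : set R) (phi : R -> R) (N : nat) (xc : 'I_N -> R)
        (m Q : nat) (p : Q.-tuple {poly_m R}).

(* v belongs to V_{N,m}, as a function on Omega.  {poly_m R} consists of the   *)
(* polynomials of size at most m, i.e. of degree less than m, and p is meant   *)
(* to be a basis of it.                                                        *)
Definition RBF_space (v : R -> R) : Prop :=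
  exists (alpha : 'I_N -> R) (beta : 'I_Q -> R),
    (forall i : 'I_Q, \sum_(n < N) alpha n * (tnth p i : {poly R}).[xc n] = 0) /\
    (forall x, Omega x ->
       v x = \sum_(n < N) alpha n * phi `|x - xc n|
             + \sum_(i < Q) beta i * (tnth p i : {poly R}).[x]).

Definition is_RBF_interpolant (w v : R -> R) : Prop :=
  RBF_space v /\ forall n, v (xc n) = w (xc n).

Definition RBF_uniquely_solvable : Prop :=
  forall w : R -> R,
    (exists v, is_RBF_interpolant w v) /\
    (forall v1 v2, is_RBF_interpolant w v1 -> is_RBF_interpolant w v2 ->
       forall x, Omega x -> v1 x = v2 x).

End RBF.

Section Flux.
Context {R : realType}.

Definition advection_flux (a u : R) : R := a * u.

Definition is_numerical_flux (f : R -> R) (fnum : R -> R -> R) : Prop :=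
  [/\ forall u, fnum u u = f u,
      lipschitz (fun z : R * R => fnum z.1 z.2),
      forall v, {homo fnum^~ v : u1 u2 / u1 <= u2}
    & forall u, {homo fnum u : v1 v2 / v1 <= v2 >-> v2 <= v1}].

Definition fnum_L (fnum : R -> R -> R) (gL : R -> R) (uN : R -> R -> R)
  (xL t : R) : R := fnum (gL t) (uN t xL).

Definition fnum_R (fnum : R -> R -> R) (gR : R -> R) (uN : R -> R -> R)
  (xR t : R) : R := fnum (uN t xR) (gR t).

End Flux.

(* Main.v *)
(* In the Lagrange basis L_n of V_{N,m}, u_N(t,x) = sum_n u_N(t,x_n) L_n(x) is *)
(* a finite sum, so d/dt commutes with the integral without any domination     *)
(* argument.  The scheme turns the integral of d/dt u_N into integrals of the  *)
(* x-derivatives of f_N, c_L and c_R, where the boundary values of c_L and c_R *)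
(* cancel those of f_N and leave the difference of the numerical fluxes.       *)

Require Import Defs.
From HB Require Import structures.
From mathcomp Require Import all_boot all_order all_algebra qpoly.
From mathcomp Require Import all_classical all_reals all_analysis.
From mathcomp Require Import ring.

Set Implicit Arguments.
Unset Strict Implicit.
Unset Printing Implicit Defensive.

Import Order.TTheory GRing.Theory Num.Theory.
Import numFieldNormedType.Exports.

Local Open Scope classical_set_scope.
Local Open Scope ring_scope.

(** Two facts carry the argument. [RBF_Lagrange_basis] separates time from space, so that the total
    mass is a finite combination of the nodal values with the constant weights [\int L n].
    [Rintegral_derive_within] is the fundamental theorem of calculus for derivatives that are
    one-sided at the endpoints, and reduces every space integral to boundary values. *)

Section DerivativeWithin.
Context {R : realType}.
Implicit Types (A : set R) (f : R -> R).

(** Away from [x], [f y] is the difference quotient times [y - x], plus [f x], and the product tends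
    to 0. The point [y = x], which the punctured filter omits, is treated separately. *)
Lemma derivable_within_continuous_at A f x :
  derivable_within A f x -> f y @[y --> within A (nbhs x)] --> f x.
Proof.
move=> df.
have cvx : f y @[y --> within A x^'] --> f x.
  pose q y := (f y - f x) / (y - x).
  have yx0 : y - x @[y --> within A x^'] --> (0 : R).
    apply: cvg_within_filter; apply: (@cvg_within_filter _ _ _ (nbhs x)).
    have := cvgB (@cvg_id _ (nbhs x)) (cvg_cst x); rewrite subrr; exact.
  have qx : q y * (y - x) + f x @[y --> within A x^'] --> f x.
    by have := cvgD (cvgM df yx0) (cvg_cst (f x)); rewrite mulr0 add0r; exact.
  apply: cvg_trans; last exact: qx.
  apply: near_eq_cvg.
  rewrite !near_withinE; near=> y => yx _.
  by rewrite /q divfK ?subrK // subr_eq0.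
move=> P Pfx.
have Px : nbhs x (fun y => y != x -> A y -> P (f y)) := cvx P Pfx.
have : nbhs x (fun y => A y -> P (f y)); last by [].
apply: filterS Px => y Py Ay.
have [->|yx] := eqVneq y x; first exact: nbhs_singleton.
exact: Py.
Unshelve. all: by end_near. Qed.

Lemma derivable_within_continuous A f :
  (forall x, A x -> derivable_within A f x) -> {within A, continuous f}.
Proof.
move=> df; apply/subspace_continuousP => x Ax.
exact/derivable_within_continuous_at/df.
Qed.

(** Near an interior point the restriction to [A] is vacuous, so the difference quotient has an
    ordinary limit; filling in that limit at [x] gives the continuous slope function of
    Caratheodory's criterion. *)
Lemma is_derive_within_interior A f x : A^° x -> derivable_within A f x ->
  is_derive x 1 f (derive_within A f x).
Proof.
move=> Ax df; apply/is_derive1_caratheodory.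
pose q y := (f y - f x) / (y - x).
exists (fun y => if y == x then derive_within A f x else q y); split.
- move=> y; case: eqVneq => [->|yx]; first by rewrite !subrr mulr0.
  by rewrite /q divfK // subr_eq0.
- apply/continuous_withinNx; rewrite eqxx.
  have qx : q y @[y --> x^'] --> derive_within A f x.
    move=> P Pl.
    have AP : nbhs x (fun y => y != x -> A y -> P (q y)) := df P Pl.
    have : nbhs x (fun y => y != x -> P (q y)); last by [].
    by apply: filterS2 AP Ax => y Py Ay yx; exact: Py.
  apply: cvg_trans; last exact: qx.
  apply: near_eq_cvg; rewrite near_withinE.
  by near=> y => yx; rewrite (negbTE yx).
- by rewrite eqxx.
Unshelve. all: by end_near. Qed.

Lemma C1_within_integrable (a b : R) f : C1_within `[a, b] f ->
  lebesgue_measure.-integrable `[a, b] (EFin \o derive_within `[a, b] f).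
Proof.
move=> [_ cf]; apply: continuous_compact_integrable => //.
exact: segment_compact.
Qed.

(** The derivative is an ordinary one inside the interval; one-sided differentiability at the
    endpoints supplies the continuity of [f] there that the fundamental theorem requires. *)
Lemma Rintegral_derive_within (a b : R) f : a < b -> C1_within `[a, b] f ->
  \int[lebesgue_measure]_(x in `[a, b]) derive_within `[a, b] f x = f b - f a.
Proof.
move=> ab [df cdf].
have dfi x : x \in `]a, b[ -> is_derive x 1 f (derive_within `[a, b] f x).
  move=> xab; apply: is_derive_within_interior.
    by rewrite interior_itv_bnd.
  by apply: df; exact: subset_itv_oo_cc.
rewrite /Rintegral (@continuous_FTC2 _ _ f) //.
- have /(continuous_within_itvP f ab)[_ fa fb] := derivable_within_continuous df.
  by split=> // x /dfi[].
- by move=> x /dfi dfx; rewrite derive1E derive_val.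
Qed.

End DerivativeWithin.

Section RintegralSum.
Context d (T : measurableType d) (R : realType) (mu : {measure set T -> \bar R}).
Context (D : set T) (mD : measurable D).

Lemma Rintegral_sum (I : Type) (s : seq I) (f : I -> T -> R) :
  (forall i, mu.-integrable D (EFin \o f i)) ->
  \int[mu]_(x in D) (\sum_(i <- s) f i x) = \sum_(i <- s) \int[mu]_(x in D) f i x.
Proof.
move=> intf; rewrite /Rintegral; under eq_integral do rewrite -sumEFin.
rewrite (@integral_sum _ _ _ _ _ mD _ (fun i x => (f i x)%:E)) //.
by rewrite sum_fine // => i _; exact: (integrable_fin_num mD (intf i)).
Qed.

Lemma Rintegral_linear_comb n (c : 'I_n -> R) (f : 'I_n -> T -> R) :
  (forall i, mu.-integrable D (EFin \o f i)) ->
  \int[mu]_(x in D) (\sum_(i < n) c i * f i x) =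
  \sum_(i < n) c i * \int[mu]_(x in D) f i x.
Proof.
move=> intf; rewrite Rintegral_sum => [|i].
  by apply: eq_bigr => i _; rewrite RintegralZl.
exact: (integrableZl mD (c i) (intf i)).
Qed.

End RintegralSum.

Section LagrangeBasis.
Context {R : realType} (Omega : set R) (phi : R -> R) (N : nat) (xc : 'I_N -> R)
        (m Q : nat) (p : Q.-tuple {poly_m R}).
Local Notation V := (RBF_space Omega phi xc p).

Lemma RBF_space0 : V (fun=> 0).
Proof.
exists (fun=> 0), (fun=> 0); split=> [i|x _].
  by rewrite big1 // => n _; rewrite mul0r.
by rewrite !big1 ?addr0 // => i _; rewrite mul0r.
Qed.

Lemma RBF_spaceD v w : V v -> V w -> V (fun x => v x + w x).
Proof.
move=> [al [be [hv ev]]] [al' [be' [hw ew]]].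
exists (fun n => al n + al' n), (fun i => be i + be' i); split=> [i|x Ox].
  under eq_bigr do rewrite mulrDl.
  by rewrite big_split /= hv hw addr0.
rewrite (ev _ Ox) (ew _ Ox) addrACA -!big_split /=.
by congr (_ + _); apply: eq_bigr => i _; rewrite mulrDl.
Qed.

Lemma RBF_spaceZ c v : V v -> V (fun x => c * v x).
Proof.
move=> [al [be [hv ev]]].
exists (fun n => c * al n), (fun i => c * be i); split=> [i|x Ox].
  under eq_bigr do rewrite -mulrA.
  by rewrite -mulr_sumr hv mulr0.
rewrite (ev _ Ox) mulrDr !mulr_sumr.
by congr (_ + _); apply: eq_bigr => i _; rewrite mulrA.
Qed.

Lemma RBF_space_linear_comb n (c : 'I_n -> R) (L : 'I_n -> R -> R) :
  (forall i, V (L i)) -> V (fun x => \sum_(i < n) c i * L i x).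
Proof.
move=> VL; rewrite (_ : (fun x => _) = \sum_(i < n) (fun x => c i * L i x)); last first.
  by apply/funext => x; rewrite fct_sumE.
elim/big_ind: _ => [|v w|i _]; [exact: RBF_space0|exact: RBF_spaceD|].
exact/RBF_spaceZ/VL.
Qed.

(** [L n] interpolates the indicator of the center [xc n], which is a Kronecker delta on the
    distinct centers. Then [v] and its expansion both lie in the space and agree at all centers, so
    uniqueness identifies them. *)
Lemma RBF_Lagrange_basis : injective xc -> RBF_uniquely_solvable Omega phi xc p ->
  exists L : 'I_N -> R -> R, (forall n, V (L n)) /\
    forall v, V v -> forall x, Omega x -> v x = \sum_(n < N) v (xc n) * L n x.
Proof.
move=> xc_inj sol.
have /choice[L hL] n : exists v,
    is_RBF_interpolant Omega phi xc p (fun x => (x == xc n)%:R) v.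
  by have [] := sol (fun x => (x == xc n)%:R).
exists L; split=> [n|v Vv]; first exact: (hL n).1.
apply: (sol v).2; first by split.
split; first by apply: RBF_space_linear_comb => n; exact: (hL n).1.
move=> k; rewrite (bigD1 k) //= (hL k).2 eqxx mulr1 big1 ?addr0 // => n nk.
by rewrite (hL n).2 (inj_eq xc_inj) eq_sym (negbTE nk) mulr0.
Qed.

End LagrangeBasis.

Theorem lemma4p1 (R : realType) (xL xR a : R) (hLR : xL < xR) (ha : 0 < a)
  (* RBF space on [xL, xR] *)
  (phi : R -> R) (N : nat) (xc : 'I_N -> R) (m Q : nat)
  (p : Q.-tuple {poly_m R})
  (hxc_inj : injective xc)
  (hxc : forall n, `[xL, xR]%classic (xc n))
  (hp : basis_of fullv p)
  (hV : RBF_uniquely_solvable `[xL, xR] phi xc p)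
  (hV1 : forall v, RBF_space `[xL, xR] phi xc p v -> C1_within `[xL, xR] v)
  (* numerical flux *)
  (fnum : R -> R -> R) (hfnum : is_numerical_flux (advection_flux a) fnum)
  (* correction functions *)
  (cL cR : R -> R)
  (hcL1 : C1_within `[xL, xR] cL) (hcR1 : C1_within `[xL, xR] cR)
  (hcL_R : cL xR = 0) (hcR_L : cR xL = 0)
  (hcR_R : cR xR = 1) (hcL_L : cL xL = 1)
  (* numerical solution, interpolated flux and boundary values *)
  (uN fN : R -> R -> R) (gL gR : R -> R)
  (huN : forall t : R, 0 < t -> RBF_space `[xL, xR] phi xc p (uN t))
  (huN1 : forall x : R, `[xL, xR]%classic x -> forall t : R, 0 < t ->
     derivable (uN^~ x) t 1 /\ {for t, continuous (derive1 (uN^~ x))})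
  (hfN : forall t : R, 0 < t ->
     is_RBF_interpolant `[xL, xR] phi xc p
       (fun x => advection_flux a (uN t x)) (fN t))
  (hgR : forall t : R, 0 < t -> gR t = uN t xR)
  (* FR-RBF semidiscretization *)
  (hFR : forall t x : R, 0 < t -> `[xL, xR]%classic x ->
     derive1 (uN^~ x) t =
       - derive_within `[xL, xR] (fN t) x
       - derive_within `[xL, xR] cL x * (fnum_L fnum gL uN xL t - fN t xL)
       - derive_within `[xL, xR] cR x * (fnum_R fnum gR uN xR t - fN t xR)) :
  forall t : R, 0 < t ->
    is_derive t 1 (fun s : R => \int[lebesgue_measure]_(x in `[xL, xR]) uN s x)
      (- (fnum_R fnum gR uN xR t - fnum_L fnum gL uN xL t)).
Proof.
move=> t t0; set Om := `[xL, xR]%classic.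
have mOm : measurable (Om : set (measurableTypeR R)) by exact: measurable_itv.
have [L [VL uL]] := RBF_Lagrange_basis hxc_inj hV.
have intL n : lebesgue_measure.-integrable Om (EFin \o L n).
  apply: continuous_compact_integrable; first exact: segment_compact.
  exact/derivable_within_continuous/(hV1 _ (VL n)).1.
have du n : is_derive t 1 (uN^~ (xc n)) (derive1 (uN^~ (xc n)) t).
  have [? _] := huN1 _ (hxc n) _ t0.
  by rewrite derive1E; exact: derivableP.
(* Used with two families of weights: [L n x] for the pointwise time derivative, and the integrals
   of [L n] for the mass. *)
have dsum (w : 'I_N -> R) : is_derive t 1 (fun s => \sum_(n < N) uN s (xc n) * w n)
    (\sum_(n < N) derive1 (uN^~ (xc n)) t * w n).
  rewrite (_ : (fun s => _) = \sum_(n < N) (w n \*: uN^~ (xc n))); last first.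
    by apply/funext => s; rewrite fct_sumE; apply: eq_bigr => n _; rewrite mulrC.
  under [X in is_derive _ _ _ X]eq_bigr do rewrite mulrC.
  by apply: is_derive_sum => n; exact: is_deriveZ.
have dtu x : Om x -> derive1 (uN^~ x) t = \sum_(n < N) derive1 (uN^~ (xc n)) t * L n x.
  move=> Ox; rewrite derive1E; apply: derive_val.
  (* The Lagrange expansion is known for positive times only, which suffices because all [s] near
     [t] are positive. *)
  apply: near_eq_is_derive (dsum (L^~ x)).
  by near=> s; rewrite -uL //; apply: huN; near: s; exact: lt_nbhsr.
suff <- : \sum_(n < N) derive1 (uN^~ (xc n)) t * \int[lebesgue_measure]_(x in Om) L n x
    = - (fnum_R fnum gR uN xR t - fnum_L fnum gL uN xL t).
  apply: near_eq_is_derive (dsum _); near=> s.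
  rewrite -Rintegral_linear_comb //; apply: eq_Rintegral => x /set_mem Ox.
  by rewrite -uL //; apply: huN; near: s; exact: lt_nbhsr.
rewrite -Rintegral_linear_comb //.
set A := fnum_L _ _ _ _ _ ; set B := fnum_R _ _ _ _ _.
have fN1 : C1_within Om (fN t) by apply: hV1; exact: (hfN t t0).1.
have intc c k : C1_within Om c ->
    lebesgue_measure.-integrable Om (EFin \o (fun x => k * derive_within Om c x)).
  by move=> c1; exact: (integrableZl mOm k (C1_within_integrable c1)).
(* The factor [-1] gives all three terms the shape covered by [intc]. *)
transitivity (\int[lebesgue_measure]_(x in Om)
    (-1 * derive_within Om (fN t) x - (A - fN t xL) * derive_within Om cL x
     - (B - fN t xR) * derive_within Om cR x)).
  apply: eq_Rintegral => x /set_mem Ox; rewrite -dtu // hFR // -/Om -/A -/B.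
  by ring.
have int_ab := integrableB mOm (intc _ (-1) fN1) (intc _ (A - fN t xL) hcL1).
rewrite (RintegralB mOm int_ab (intc _ _ hcR1)).
rewrite (RintegralB mOm (intc _ _ fN1) (intc _ _ hcL1)).
rewrite !(RintegralZl _ mOm) ?Rintegral_derive_within //; try exact: C1_within_integrable.
(* The increments of [cL] and [cR] over the interval are -1 and 1, so the corrections contribute
   [A - fN t xL] and [- (B - fN t xR)]; with [fN t xL - fN t xR] from the first term, [A - B]
   remains. *)
rewrite hcL_R hcR_L hcR_R hcL_L.
by ring.
Unshelve. all: by end_near. Qed.
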